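(* Let $G$ be a graph of diameter two. Then $|\mathcal{L}(G)| < |V(G)|$ (that is, $G$ has fewer lines than vertices) if and only if $G$ is isomorphic to one of the ten graphs in the family $$\mathcal{F}=\{K_{1,2},\,K_{2,2},\,K_{2,3},\,K_{1,2,2},\,K_{1,2,2}',\,K_{1,2,2}'',\,M_6,\,K_6',\,M_8,\,K_8'\}.$$
   Context: Graphs are finite, simple and undirected. A graph $G=(V,E)$ has diameter two if it is connected and the maximum distance between two of its vertices is exactly $2$. Lines. For distinct vertices $x,y$ of $G$, the line $\overline{xy}$ defined by $\{x,y\}$ is the set of all vertices $z$ such that there is a shortest path of $G$ (a shortest path between its two endpoints) containing $x$, $y$ and $z$; in particular $x,y\in\overline{xy}$. When $G$ has diameter two, this means: if $xy\notin E$, then $\overline{xy}=\{x,y\}\cup (N(x)\cap N(y))$; if $xy\in E$, then $\overline{xy}=\{x,y\}\cup (N(x)\setminus N(y))\cup (N(y)\setminus N(x))$, where $N(v)$ denotes the set of neighbors of $v$. The set of all lines is $\mathcal{L}(G)=\{\overline{xy}\mid x,y\in V,\ x\neq y\}$; it is a set of subsets of $V$, so equal lines defined by different pairs are counted once. The graphs in $\mathcal{F}$: - $K_{1,2}$, $K_{2,2}$, $K_{2,3}$ are the complete bipartite graphs with parts of the indicated sizes (so $K_{1,2}$ is the path with three vertices and $K_{2,2}$ is the cycle of length four). - $K_{1,2,2}$ is the complete multipartite graph with parts of sizes $1,2,2$. - $K_{1,2,2}'$ is the graph obtained from $K_{1,2,2}$ by deleting one edge incident to the vertex of degree four. - $K_{1,2,2}''$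 (the house) is the graph obtained from $K_{1,2,2}$ by deleting two edges incident to the vertex of degree four, in such a way that the vertices of degree two in the resulting graph do not form an independent set; equivalently, it is a cycle of length five together with one chord. - For $p\in\{3,4\}$, $M_{2p}$ is the graph on $2p$ vertices obtained from two disjoint copies of the complete graph $K_p$ by joining them by a perfect matching (each vertex of one copy is adjacent to exactly one vertex of the other copy and vice versa). - For $p\in\{3,4\}$, $K_{2p}'$ is the complete multipartite graph on $2p$ vertices with $p$ parts, all of size two. *)

(* Defs.v *)
From mathcomp Require Import all_boot.

Set Implicit Arguments.
Unset Strict Implicit.
Unset Printing Implicit Defensive.

Record graph : Type := Graph {
  vertex :> finType;
  adj : rel vertex;
  adj_sym : symmetric adj;
  adj_irr : irreflexive adj }.

Arguments adj {g}.

Definition iso (G H : graph) : Prop :=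
  exists f : G -> H, bijective f /\ (forall x y, adj (f x) (f y) = adj x y).

Section Lines.
Variable G : graph.
Implicit Types (x y z u : G) (p : seq G).

Definition connected : Prop := forall x y, connect adj x y.

Definition has_walk (n : nat) x y : bool :=
  [exists p : n.-tuple G, path adj x p && (last x p == y)].

(* Length of a shortest walk from x to y; the search stops below #|G|, which
   loses nothing since shortest walks repeat no vertex, and the value is #|G|
   when y cannot be reached from x. *)
Definition dist x y : nat := find (fun n => has_walk n x y) (iota 0 #|G|).

Definition diameter : nat := \max_(x : G) \max_(y : G) dist x y.

Definition diameter_two : Prop := connected /\ diameter = 2.

Definition shortest_path x p : bool :=
  path adj x p && (size p == dist x (last x p)).

(* The endpoints of the shortest path u :: p are arbitrary: x and y may be
   interior to it. *)
Definition line x y : {set G} :=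
  [set z | [exists u : G, exists n : 'I_#|G|, exists p : n.-tuple G,
     shortest_path u p &&
     [&& x \in u :: p, y \in u :: p & z \in u :: p]]].

Definition lines : {set {set G}} :=
  [set line xy.1 xy.2 | xy : G * G & xy.1 != xy.2].

End Lines.

Section Multipartite.
Variable s : seq nat.

(* The parts of the complete multipartite graph with part sizes s are the
   successive intervals of {0, ..., sumn s - 1} of lengths s_0, s_1, ...;
   reshape_index s i is the index of the part containing i. *)
Definition multipartite_adj : rel 'I_(sumn s) :=
  fun x y => reshape_index s x != reshape_index s y.

Lemma multipartite_sym : symmetric multipartite_adj.
Proof. by move=> x y; rewrite /multipartite_adj eq_sym. Qed.

Lemma multipartite_irr : irreflexive multipartite_adj.
Proof. by move=> x; rewrite /multipartite_adj eqxx. Qed.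

Definition multipartite : graph := Graph multipartite_sym multipartite_irr.

End Multipartite.

Section DeleteEdge.
Variables (G : graph) (u v : G).

Definition delete_edge_adj : rel G :=
  fun x y => adj x y && ((x, y) \notin [:: (u, v); (v, u)]).

Lemma delete_edge_sym : symmetric delete_edge_adj.
Proof.
move=> x y; rewrite /delete_edge_adj adj_sym !inE !xpair_eqE.
by rewrite [(y == u) && _]andbC [(y == v) && _]andbC orbC.
Qed.

Lemma delete_edge_irr : irreflexive delete_edge_adj.
Proof. by move=> x; rewrite /delete_edge_adj adj_irr. Qed.

Definition delete_edge : graph := Graph delete_edge_sym delete_edge_irr.

End DeleteEdge.

Section MatchedCliques.
Variable p : nat.

(* Two copies of K_p, indexed by bool, joined by the matching
   (false, i) -- (true, i). *)
Definition matched_cliques_adj : rel (bool * 'I_p) :=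
  fun x y => if x.1 == y.1 then x.2 != y.2 else x.2 == y.2.

Lemma matched_cliques_sym : symmetric matched_cliques_adj.
Proof.
by move=> x y; rewrite /matched_cliques_adj ![y.1 == _]eq_sym ![y.2 == _]eq_sym.
Qed.

Lemma matched_cliques_irr : irreflexive matched_cliques_adj.
Proof. by move=> x; rewrite /matched_cliques_adj !eqxx. Qed.

Definition matched_cliques : graph :=
  Graph matched_cliques_sym matched_cliques_irr.

End MatchedCliques.

Definition K12 : graph := multipartite [:: 1; 2].
Definition K22 : graph := multipartite [:: 2; 2].
Definition K23 : graph := multipartite [:: 2; 3].

(* The parts are {0}, {1, 2} and {3, 4}; vertex 0 is the one of degree four. *)
Definition K122 : graph := multipartite [:: 1; 2; 2].

Definition K122_vertex (i : nat) (lt_i5 : i < 5) : K122 := Ordinal lt_i5.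

Definition K122' : graph :=
  delete_edge (@K122_vertex 0 isT) (@K122_vertex 1 isT).

(* The vertices left with degree two are 0, 1 and 3, and 1, 3 are adjacent;
   deleting 0-1 and 0-2 instead would leave 0, 1, 2 independent. *)
Definition K122'' : graph :=
  @delete_edge K122' (@K122_vertex 0 isT) (@K122_vertex 3 isT).

Definition M2 (p : nat) : graph := matched_cliques p.

Definition K2' (p : nat) : graph := multipartite (nseq p 2).

Definition familyF : seq graph :=
  [:: K12; K22; K23; K122; K122'; K122''; M2 3; K2' 3; M2 4; K2' 4].

(* Main.v *)
Require Import Defs.
From Stdlib Require List.
From mathcomp Require Import all_boot zify.

(* In diameter two the line of x and y is N(x) + N(y) (symmetric difference) if
   x and y are adjacent, and {x, y} together with their common neighbors
   otherwise.  These formulas make sense in any graph and restrict to induced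
   subgraphs, so the number of lines can only grow with the vertex set; hence
   the graphs with at most nine lines can be enumerated by adding one vertex at
   a time.  There is none on nine vertices, and on three to eight vertices those
   with fewer lines than vertices are exactly the ten of the family.

   It remains to find at least n lines in any graph on n > 10 vertices.
   - No two vertices have the same neighborhood.  The lines through x are
     pairwise distinct, except that the line of x and a neighbor y may be the
     line of x and a non-neighbor z; the c(x) such y, the pivots of x, form a
     clique.  So with fewer than n lines, at most c(x) lines avoid x.  Lines
     inside the clique give c(x) <= 3.  For a pivot y of x, the lines of y with
     the common neighbors of x and y give deg(y) <= c(x) + 2 <= 5, while a pivot
     of y forces deg(y) >= n - 4.
   - u and u' have the same neighborhood (are twins).  By induction there are
     n - 2 lines in G - {u, u'}, and two more lines of G not generated there are
     enough.  They exist if u and u' have a common non-neighbor z (the lines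
     uz and u'z separate u from u') or if there is another pair of twins.
     Otherwise {u, u'} is joined to all the rest, whose vertices r give n - 2
     distinct lines ur, and two lines generated by edges outside {u, u'}
     avoid u. *)

Set Implicit Arguments.
Unset Strict Implicit.
Unset Printing Implicit Defensive.

(** * Lines of metrics with distances 1 and 2 *)

(** Stated for a boolean relation on any [eqType], so that one formula serves for graphs and is
    evaluated on codes over [nat]. *)
Definition collinear (T : eqType) (r : rel T) x y z : bool :=
  if r x y then r x z (+) r y z else [|| z == x, z == y | r x z && r y z].

Section MetricLines.
Variable G : graph.

Definition mline (x y : G) : {set G} := [set z | collinear adj x y z].

Definition mlines : {set {set G}} :=
  [set mline xy.1 xy.2 | xy : G * G & xy.1 != xy.2].

Lemma in_mline x y z : (z \in mline x y) = collinear adj x y z.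
Proof. by rewrite inE. Qed.

Lemma mline_in x y : x != y -> mline x y \in mlines.
Proof. by move=> xy; apply/imsetP; exists (x, y); rewrite ?inE. Qed.

Lemma mlinesP L : reflect (exists x y, x != y /\ L = mline x y) (L \in mlines).
Proof.
apply: (iffP imsetP) => [[[x y]] /=|[x [y [xy ->]]]].
  by rewrite inE /= => xy ->; exists x, y.
by exists (x, y); rewrite ?inE.
Qed.

End MetricLines.

(** * Enumeration of the graphs with few lines *)

Section LazyHas.
Variables (T : Type) (a : T -> bool).

(* [vm_compute] is call-by-value, so [||] and [&&] do not short-circuit. *)
Fixpoint lazy_has (s : seq T) : bool :=
  if s is x :: s' then if a x then true else lazy_has s' else false.

Lemma lazy_hasE s : lazy_has s = has a s.
Proof. by elim: s => //= x s ->; case: (a x). Qed.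

End LazyHas.

(** * Adjacency codes of vertex lists and their isomorphism *)

Section Codes.
Variables (T : Type) (r : T -> T -> bool).

(** [p] lists the vertices already read. A row records adjacency to earlier vertices only, so a new
    last vertex appends one row and changes no other. *)
Fixpoint code_from (p s : seq T) : seq bitseq :=
  if s is x :: s' then map (r x) p :: code_from (rcons p x) s' else [::].

Definition code (s : seq T) : seq bitseq := code_from [::] s.

Lemma code_from_rcons p s x :
  code_from p (rcons s x) = rcons (code_from p s) (map (r x) (p ++ s)).
Proof.
elim: s p => [|y s IHs] p /=; first by rewrite cats0.
by rewrite IHs cat_rcons.
Qed.

Lemma code_rcons s x : code (rcons s x) = rcons (code s) (map (r x) s).
Proof. exact: code_from_rcons. Qed.

Lemma size_code s : size (code s) = size s.
Proof. by elim/last_ind: s => // s x IHs; rewrite code_rcons !size_rcons IHs. Qed.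

Lemma nth_code x0 s i : i < size s ->
  nth [::] (code s) i = map (r (nth x0 s i)) (take i s).
Proof.
elim/last_ind: s => // s x IHs; rewrite size_rcons code_rcons !nth_rcons size_code.
rewrite -cats1 take_cat ltnS leq_eqVlt => /predU1P[->|lt_is].
  by rewrite ltnn eqxx subnn cats0.
by rewrite lt_is IHs.
Qed.

End Codes.

Lemma code_map (T U : Type) (f : T -> U) (r : U -> U -> bool) s :
  code r (map f s) = code (fun x y => r (f x) (f y)) s.
Proof.
elim/last_ind: s => // s x IHs.
by rewrite map_rcons !code_rcons IHs -map_comp.
Qed.

Lemma eq_in_code (T : eqType) (r r' : rel T) s :
  {in s &, r =2 r'} -> code r s = code r' s.
Proof.
elim/last_ind: s => // s x IHs eq_r; rewrite !code_rcons IHs => [|y z ys zs].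
  congr rcons; apply/eq_in_map => y ys.
  by apply: eq_r; rewrite mem_rcons inE ?eqxx ?ys ?orbT.
by apply: eq_r; rewrite mem_rcons inE ?ys ?zs ?orbT.
Qed.

(* The rows of a code are the lower triangle of an adjacency matrix. *)
Definition code_adj (c : seq bitseq) : rel nat := fun i j =>
  if i < j then nth false (nth [::] c j) i
  else (j < i) && nth false (nth [::] c i) j.

Lemma code_adjE (T : eqType) (r : rel T) x0 s i j :
    symmetric r -> irreflexive r -> i < size s -> j < size s ->
  code_adj (code r s) i j = r (nth x0 s i) (nth x0 s j).
Proof.
move=> rC rI is_ js; rewrite /code_adj.
have entry k l : k < l -> l < size s ->
    nth false (nth [::] (code r s) l) k = r (nth x0 s l) (nth x0 s k).
  move=> kl ls; rewrite (nth_code _ x0) // (nth_map x0) ?nth_take //.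
  by rewrite size_takel // ltnW.
by case: ltngtP => [ij|ji|->] /=; rewrite ?entry // rC.
Qed.

(** Backtracking search: [p] holds the vertices chosen so far, [c] the rows still to be realized. *)
Fixpoint extends_to (r : rel nat) (avail : seq nat) (c : seq bitseq)
    (p : seq nat) : bool :=
  if c is row :: c' then
    lazy_has (fun v =>
      if v \in p then false
      else if map (r v) p == row then extends_to r avail c' (rcons p v)
      else false) avail
  else true.

Definition code_iso (c d : seq bitseq) : bool :=
  if size c == size d then
    extends_to (code_adj c) (iota 0 (size c)) d [::]
  else false.

Lemma extends_toP r avail c p : extends_to r avail c p -> uniq p ->
  exists q, [/\ uniq (p ++ q), {subset q <= avail} & code_from r p q = c].
Proof.
elim: c p => [|row c IHc] p /=; first by exists [::]; rewrite cats0.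
rewrite lazy_hasE => /hasP[v v_avail]; case: ifPn => // vp.
case: eqP => // <- /IHc IH p_uniq.
have [|q [q_uniq q_avail <-]] := IH; first by rewrite rcons_uniq vp.
exists (v :: q); split=> //; first by rewrite -cat_rcons.
by move=> w; rewrite inE => /predU1P[->|/q_avail].
Qed.

Lemma code_isoP (T : eqType) (r : rel T) s d :
    symmetric r -> irreflexive r -> uniq s -> code_iso (code r s) d ->
  exists2 s', perm_eq s' s & code r s' = d.
Proof.
rewrite /code_iso size_code => rC rI s_uniq; case: eqP => // sz_d.
case/extends_toP=> // q [/= q_uniq q_sub def_d].
case: s => [|x0 s0] in s_uniq sz_d q_sub def_d *.
  by exists [::] => //; case: d sz_d {def_d}.
set s := x0 :: s0 in s_uniq sz_d q_sub def_d *.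
have sz_q : size q = size s.
  by rewrite sz_d -def_d -[code_from _ _ _]/(code _ q) size_code.
(* The indices found are distinct, below [size s], and as many as [size s]. *)
have q_iota : perm_eq q (iota 0 (size s)).
  apply: uniq_perm; rewrite ?iota_uniq //.
  by have [|_] := uniq_min_size q_uniq q_sub; rewrite ?size_iota ?sz_q.
exists (map (nth x0 s) q).
  by rewrite -{2}(mkseq_nth x0 s) /mkseq perm_map.
rewrite code_map -def_d; apply: eq_in_code => i j.
by rewrite !(perm_mem q_iota) !mem_iota => iq jq; rewrite (code_adjE x0).
Qed.

(** * Lines restricted to a vertex list *)

Section Traces.
Variables (T : eqType) (r : rel T).

(** Each pair from [t] is taken once; its line becomes the bit vector of its membership along
    [s]. *)
Fixpoint traces_from (s t : seq T) : seq bitseq :=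
  if t is x :: t' then
    [seq map (collinear r x y) s | y <- t'] ++ traces_from s t'
  else [::].

Definition traces (s : seq T) : seq bitseq := traces_from s s.

Lemma traces_fromP s t b : uniq t -> b \in traces_from s t ->
  exists x y, [/\ x \in t, y \in t, x != y & b = map (collinear r x y) s].
Proof.
elim: t => //= x t IHt /andP[xt t_uniq]; rewrite mem_cat => /orP[/mapP[y yt ->]|].
  exists x, y; split; rewrite ?inE ?eqxx ?yt ?orbT //.
  by apply: contraNneq xt => ->.
move/(IHt t_uniq)=> [y [z [yt zt yz ->]]].
by exists y, z; rewrite !inE yt zt !orbT.
Qed.

Lemma collinearC x y z : symmetric r -> collinear r x y z = collinear r y x z.
Proof. by move=> rC; rewrite /collinear rC addbC andbC orbCA. Qed.

Lemma traces_from_in s t x y : symmetric r -> x \in t -> y \in t -> x != y ->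
  map (collinear r x y) s \in traces_from s t.
Proof.
move=> rC; elim: t => //= u t IHt.
rewrite !inE mem_cat => /predU1P[->|xt] /predU1P[->|yt] xy.
- by rewrite eqxx in xy.
- by apply/orP; left; apply/mapP; exists y.
- by rewrite (eq_map (fun z => collinearC x u z rC)); apply/orP; left; apply/mapP; exists x.
- by rewrite IHt ?orbT.
Qed.

End Traces.

Lemma eq_in_traces (T : eqType) (r r' : rel T) s :
  {in s &, r =2 r'} -> traces r s = traces r' s.
Proof.
move=> eq_r.
suff eq_from t : {subset t <= s} -> traces_from r s t = traces_from r' s t.
  exact: eq_from.
elim: t => //= x t IHt ts.
have xs : x \in s by apply: ts; rewrite mem_head.
have ts' : {subset t <= s} by move=> y yt; apply: ts; rewrite inE yt orbT.
rewrite IHt //; congr (_ ++ _); apply/eq_in_map => y /ts' ys.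
by apply/eq_in_map => z zs; rewrite /collinear !eq_r.
Qed.

Lemma traces_map (T U : eqType) (f : T -> U) (r : rel U) s :
  {in s &, injective f} ->
  traces r (map f s) = traces (relpre f r) s.
Proof.
move=> f_inj; suff eq_from t : {subset t <= s} ->
    traces_from r (map f s) (map f t) = traces_from (relpre f r) s t.
  exact: eq_from.
elim: t => //= x t IHt ts.
have xs : x \in s by apply: ts; rewrite mem_head.
have ts' : {subset t <= s} by move=> y yt; apply: ts; rewrite inE yt orbT.
rewrite IHt // -map_comp; congr (_ ++ _); apply/eq_in_map => y /ts' ys /=.
rewrite -map_comp; apply/eq_in_map => z zs.
by rewrite /collinear /= !(inj_in_eq f_inj).
Qed.

Definition nb_lines (c : seq bitseq) : nat :=
  size (undup (traces (code_adj c) (iota 0 (size c)))).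

Lemma spanning_mem (G : graph) (s : seq G) : uniq s -> size s = #|G| -> s =i G.
Proof.
move=> s_uniq sz_s.
have s_sub : {subset s <= enum G} by move=> y _; rewrite mem_enum.
have [|_ s_G] := uniq_min_size s_uniq s_sub; first by rewrite -cardE sz_s.
by move=> x; rewrite s_G mem_enum.
Qed.

Section CountLines.
Variable G : graph.
Implicit Type s : seq G.

Lemma nb_lines_code s :
  uniq s -> nb_lines (code adj s) = size (undup (traces adj s)).
Proof.
case: s => [|x0 s0] // s_uniq; set s := x0 :: s0 in s_uniq *.
rewrite -{2}(mkseq_nth x0 s) /mkseq traces_map => [|i j]; last first.
  by rewrite !mem_iota => /= is_ js /eqP; rewrite nth_uniq // => /eqP.
congr (size (undup _)); rewrite size_code; apply: eq_in_traces => i j.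
by rewrite !mem_iota => is_ js; rewrite (code_adjE x0) //; [apply: adj_sym|apply: adj_irr].
Qed.

(** Collinearity involves only three vertices, so every trace on [s] is the restriction of a line of
    [G], and distinct traces come from distinct lines. *)
Lemma nb_lines_le s : uniq s -> nb_lines (code adj s) <= #|mlines G|.
Proof.
move=> s_uniq; rewrite nb_lines_code //.
rewrite cardE -(size_map (fun L : {set G} => map (mem L) s)).
apply: uniq_leq_size (undup_uniq _) _ => b; rewrite mem_undup.
case/traces_fromP=> // x [y [_ _ xy ->]]; apply/mapP; exists (mline x y).
  by rewrite mem_enum mline_in.
by apply/eq_map => z; rewrite /= in_mline.
Qed.

Lemma nb_linesE s :
  uniq s -> size s = #|G| -> nb_lines (code adj s) = #|mlines G|.
Proof.
move=> s_uniq sz_s; apply/eqP; rewrite eqn_leq nb_lines_le //= nb_lines_code //.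
have s_G := spanning_mem s_uniq sz_s.
rewrite cardE -(size_map (fun L : {set G} => map (mem L) s)).
apply: uniq_leq_size => [|b].
  rewrite map_inj_uniq ?enum_uniq // => L L' /eq_in_map eqL.
  by apply/setP => x; apply: (eqL x); rewrite s_G.
case/mapP=> L; rewrite mem_enum => /mlinesP[x [y [xy ->]]] ->.
rewrite mem_undup.
under eq_map do rewrite /= in_mline.
by apply: traces_from_in; rewrite ?s_G //; apply: adj_sym.
Qed.

End CountLines.

Fixpoint bits (n : nat) : seq bitseq :=
  if n is n'.+1 then
    map (cons true) (bits n') ++ map (cons false) (bits n')
  else [:: [::]].

Lemma mem_bits b : b \in bits (size b).
Proof.
elim: b => //= -[] b IHb; rewrite mem_cat map_f ?orbT //.
Qed.

(** * Vertex-by-vertex generation of graphs with at most [M] lines *)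

Section Search.
Variable M : nat.

Definition add_new (acc : seq (seq bitseq)) (c : seq bitseq) :=
  if nb_lines c <= M then if lazy_has (code_iso c) acc then acc else c :: acc
  else acc.

Fixpoint few_line_codes (n : nat) : seq (seq bitseq) :=
  if n is n'.+1 then
    foldl add_new [::] [seq rcons c b | c <- few_line_codes n', b <- bits n']
  else [:: [::]].

Lemma foldl_add_new_sub acc cs : {subset acc <= foldl add_new acc cs}.
Proof.
elim: cs acc => [|c cs IHcs] acc d d_acc //=; apply: IHcs.
by rewrite /add_new lazy_hasE; do 2?case: ifP; rewrite ?inE ?d_acc ?orbT.
Qed.

Lemma foldl_add_new_has acc cs c : c \in cs -> nb_lines c <= M ->
  (c \in foldl add_new acc cs) || has (code_iso c) (foldl add_new acc cs).
Proof.
elim: cs acc => //= d cs IHcs acc; rewrite inE => /predU1P[<- c_few|]; last exact: IHcs.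
have sub := @foldl_add_new_sub (add_new acc c) cs.
move: sub; rewrite {1}/add_new c_few lazy_hasE; case: ifP => [/hasP[e e_acc ce] sub|_ sub].
  by apply/orP; right; apply/hasP; exists e => //; apply: sub.
by rewrite sub ?mem_head.
Qed.

(** Every sublist also has at most [M] traces, so no prefix is discarded for its lines. A code
    discarded as isomorphic to a kept one costs only a reordering of the vertices. *)
Lemma few_line_codesP (G : graph) (s : seq G) : #|mlines G| <= M -> uniq s ->
  exists2 s', perm_eq s' s & code adj s' \in few_line_codes (size s).
Proof.
move=> G_few; elim/last_ind: s => [|s x IHs]; first by exists [::].
rewrite rcons_uniq => /andP[xs s_uniq]; have [t ts t_in] := IHs s_uniq.
have tx_uniq : uniq (rcons t x).
  by rewrite rcons_uniq (perm_uniq ts) s_uniq (perm_mem ts) xs.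
have tx_s : perm_eq (rcons t x) (rcons s x).
  by rewrite -!cats1 perm_cat2r.
rewrite size_rcons /=.
set cs := [seq rcons c b | c <- _, b <- _].
have tx_cs : code adj (rcons t x) \in cs.
  rewrite code_rcons; apply: allpairs_f => //.
  by rewrite -(perm_size ts) -(size_map (adj x)) mem_bits.
case/orP: (foldl_add_new_has [::] tx_cs (leq_trans (nb_lines_le tx_uniq) G_few)).
  by exists (rcons t x).
case/hasP=> d d_in /code_isoP[||//|s' s'_tx def_d]; try exact: adj_sym; try exact: adj_irr.
by exists s'; rewrite ?def_d // (perm_trans s'_tx).
Qed.

End Search.

(** * Codes of the ten graphs and the outcome of the enumeration *)

Definition coded (G : graph) (c : seq bitseq) : Prop :=
  exists s : seq G, [/\ uniq s, size s = #|G| & code adj s = c].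

Lemma nb_lines_coded (G : graph) c : coded G c -> nb_lines c = #|mlines G|.
Proof. by case=> s [s_uniq sz_s <-]; apply: nb_linesE. Qed.

Lemma size_coded (G : graph) c : coded G c -> size c = #|G|.
Proof. by case=> s [_ sz_s <-]; rewrite size_code. Qed.

Lemma coded_iso (G H : graph) c : iso G H -> coded H c -> coded G c.
Proof.
case=> f [[g fK gK] f_adj] [s [s_uniq sz_s <-]]; exists (map g s); split.
- by rewrite map_inj_uniq //; apply: can_inj gK.
- by rewrite size_map sz_s; apply: bij_eq_card; exists f.
- by rewrite code_map; apply: eq_in_code => x y _ _; rewrite -f_adj !gK.
Qed.

Lemma iso_coded (G H : graph) c d :
  coded G c -> coded H d -> code_iso c d -> iso G H.
Proof.
case=> s [s_uniq sz_s <-] [t [t_uniq sz_t <-]].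
case/code_isoP=> // [||s' s's def_t]; [exact: adj_sym|exact: adj_irr|].
have s'_uniq : uniq s' by rewrite (perm_uniq s's).
have sz_s' : size s' = #|G| by rewrite (perm_size s's).
have sz_st : size s' = size t by rewrite -(size_code (@adj G)) def_t size_code.
have G_s' := spanning_mem s'_uniq sz_s'; have H_t := spanning_mem t_uniq sz_t.
(* [nth] needs default vertices; if there are none, both graphs are empty and the bijection is
   vacuous. *)
case: t => [|y0 t0] in t_uniq sz_t def_t sz_st H_t *.
  have G0 (x : G) : False by have := G_s' x; rewrite (size0nil sz_st).
  exists (fun x => False_rect H (G0 x)); split=> [|x]; last by case: (G0 x).
  have H0 (y : H) : False by have := H_t y.
  by exists (fun y => False_rect G (H0 y)) => x; [case: (G0 x)|case: (H0 x)].
case: s' => [|x0 s0] // in s's def_t s'_uniq sz_s' sz_st G_s' *.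
set s1 := x0 :: s0 in s's def_t s'_uniq sz_s' sz_st G_s' *.
set t1 := y0 :: t0 in t_uniq sz_t def_t sz_st H_t *.
have lt_s x : index x s1 < size s1 by rewrite index_mem G_s'.
have lt_t y : index y t1 < size t1 by rewrite index_mem H_t.
exists (fun x => nth y0 t1 (index x s1)); split.
  exists (fun y => nth x0 s1 (index y t1)) => [x|y].
    by rewrite index_uniq -?sz_st // nth_index ?G_s'.
  by rewrite index_uniq ?sz_st // nth_index ?H_t.
move=> x y.
rewrite -(code_adjE y0 (@adj_sym H) (@adj_irr H)) -?sz_st // -def_t.
by rewrite (code_adjE x0 (@adj_sym G) (@adj_irr G)) // !nth_index ?G_s'.
Qed.

(* Unlike [enum 'I_n], this list can be computed. *)
Fixpoint ordinals (n : nat) : seq 'I_n :=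
  if n is m.+1 then ord0 :: map (lift ord0) (ordinals m) else [::].

Definition matched_vertices (p : nat) : seq (M2 p) :=
  [seq (b, i) | b <- [:: false; true], i <- ordinals p].

Definition family_codes : seq (seq bitseq) :=
  [:: code adj (ordinals _ : seq K12);
      code adj (ordinals _ : seq K22);
      code adj (ordinals _ : seq K23);
      code adj (ordinals _ : seq K122);
      code adj (ordinals _ : seq K122');
      code adj (ordinals _ : seq K122'');
      code adj (matched_vertices 3);
      code adj (ordinals _ : seq (K2' 3));
      code adj (matched_vertices 4);
      code adj (ordinals _ : seq (K2' 4))].

Lemma family_coded i : i < 10 ->
  coded (List.nth i familyF K12) (nth [::] family_codes i).
Proof.
move=> i_lt10; have: i \in iota 0 10 by rewrite mem_iota.
rewrite !inE.
do ![case/orP]; move/eqP=> -> {i i_lt10} /=;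
  eexists; (split; last by []);
  by [|vm_compute|rewrite ?card_ord ?card_prod ?card_bool ?card_ord].
Qed.

Lemma family_codes_few :
  all (fun c => nb_lines c < size c) family_codes.
Proof. by vm_compute. Qed.

(** [iota 3 6] runs over the sizes 3 to 8. There, fewer lines than vertices means fewer than nine
    lines, so the bound 9 loses no candidate. *)
Lemma few_line_codes_family :
  all (fun n =>
         all (fun c => if nb_lines c < n then has (code_iso c) family_codes
                       else true)
           (few_line_codes 9 n))
    (iota 3 6).
Proof. by vm_compute. Qed.

Lemma few_line_codes9 : few_line_codes 9 9 = [::].
Proof. by vm_compute. Qed.

Lemma card_mlines9 (G : graph) : 9 <= #|G| -> 9 < #|mlines G|.
Proof.
rewrite [#|G|]cardE => G_ge9; have sz9 := size_takel G_ge9; rewrite ltnNge.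
apply: contra_notN (notF) => G_few.
(* Any nine vertices would yield a member of the empty list [few_line_codes 9 9]. *)
have [s' _] := few_line_codesP G_few (take_uniq 9 (enum_uniq G)).
by rewrite sz9 few_line_codes9.
Qed.

Lemma card_mlines_family (G : graph) :
  (exists H, List.In H familyF /\ iso G H) -> #|mlines G| < #|G|.
Proof.
case=> H [H_F G_H].
have [i [/ltP i_lt10 def_H]] := List.In_nth familyF H K12 H_F.
have i_lt : i < size family_codes by [].
have H_c := family_coded i_lt10; rewrite def_H in H_c.
have G_c := coded_iso G_H H_c.
rewrite -(nb_lines_coded G_c) -(size_coded G_c).
exact: (allP family_codes_few) (mem_nth [::] i_lt).
Qed.

Lemma family_card_mlines (G : graph) :
  2 < #|G| < 9 -> #|mlines G| < #|G| -> exists H, List.In H familyF /\ iso G H.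
Proof.
move=> /andP[G_gt2 G_lt9] G_few.
have few9 : #|mlines G| <= 9 by rewrite ltnW // (ltn_trans G_few).
have [s' s'_G] := few_line_codesP few9 (enum_uniq G).
rewrite -cardE => s'_few.
have G_s' : coded G (code adj s').
  exists s'; split=> //; first by rewrite (perm_uniq s'_G) enum_uniq.
  by rewrite (perm_size s'_G) -cardE.
have G_in : #|G| \in iota 3 6 by rewrite mem_iota G_gt2.
have /allP/(_ _ s'_few) := allP few_line_codes_family _ G_in.
rewrite (nb_lines_coded G_s') G_few => /(has_nthP [::])[i i_lt10 s'_i].
exists (List.nth i familyF K12); split.
  by apply: List.nth_In; apply/ltP.
exact: iso_coded G_s' (family_coded i_lt10) s'_i.
Qed.

(** * Lines in diameter two *)

Section DiameterTwo.
Variable G : graph.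
Implicit Types (x y z u : G) (p : seq G).

Lemma has_walkP n x y :
  reflect (exists p, [/\ size p = n, path adj x p & last x p = y])
          (has_walk n x y).
Proof.
apply: (iffP existsP) => [[p /andP[xp /eqP p_y]]|[p [sz_p xp p_y]]].
  by exists p; rewrite size_tuple.
have sz_p' : size p == n by apply/eqP.
by exists (Tuple sz_p'); rewrite /= xp p_y eqxx.
Qed.

Lemma dist_le n x y : has_walk n x y -> dist x y <= n.
Proof.
move=> xy; have [lt_n|le_n] := ltnP n #|G|; last first.
  by apply: leq_trans le_n; rewrite -[X in _ <= X](size_iota 0) find_size.
rewrite leqNgt; apply/negP => /(before_find 0).
by rewrite nth_iota // add0n xy.
Qed.

Hypothesis diamG : diameter_two G.

(** A path shortened to one without repetition has fewer than [#|G|] edges, so the search in [dist]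
    succeeds and never returns its default. *)
Lemma dist_lt_card x y : dist x y < #|G|.
Proof.
case: diamG => /(_ x y)/connectP[p xp def_y] _.
case/shortenP: xp def_y => p' xp' p'_uniq _ def_y.
have xy : has_walk (size p') x y by apply/has_walkP; exists p'.
apply: leq_ltn_trans (dist_le xy) _.
by rewrite (leq_trans _ (max_card (mem (x :: p')))) // (card_uniqP p'_uniq).
Qed.

Lemma has_walk_dist x y : has_walk (dist x y) x y.
Proof.
have := dist_lt_card x y; rewrite -{1}(size_iota 0 #|G|) -has_find.
by move/(nth_find 0); rewrite nth_iota ?add0n // dist_lt_card.
Qed.

Lemma dist_le2 x y : dist x y <= 2.
Proof.
case: diamG => _ <-.
apply: leq_trans (leq_bigmax (F := fun x => \max_(y : G) dist x y) x).
exact: (leq_bigmax (F := dist x)).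
Qed.

Lemma card_gt2 : 2 < #|G|.
Proof.
have [_ diam2] := diamG; have [x _ | G0] := pickP (mem G); last first.
  by move: diam2; rewrite /diameter big_pred0.
rewrite -(ltn_predK (dist_lt_card x x)) ltnS -diam2.
apply/bigmax_leqP => y _; apply/bigmax_leqP => z _.
by rewrite -ltnS (ltn_predK (dist_lt_card x x)) dist_lt_card.
Qed.

Lemma shortest_path1 u a : adj u a -> shortest_path u [:: a].
Proof.
move=> ua; rewrite /shortest_path /= ua eqn_leq /=; apply/andP; split; last first.
  by apply: dist_le; apply/has_walkP; exists [:: a]; rewrite /= ua.
rewrite lt0n; apply/eqP => d0; have := has_walk_dist u a.
by rewrite d0 => /has_walkP[[|? ?] [] // _ _ /= def_a]; rewrite def_a adj_irr in ua.
Qed.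

Lemma shortest_path2 u a b : adj u a -> adj a b -> u != b -> ~~ adj u b ->
  shortest_path u [:: a; b].
Proof.
move=> ua ab neq_ub nub; rewrite /shortest_path /= ua ab eqn_leq dist_le2 andbT.
have := has_walk_dist u b; case: (dist u b) => [|[|//]] /has_walkP[].
  by case=> [|? ?] [] // _ _ /= def_b; rewrite def_b eqxx in neq_ub.
case=> [|c [|? ?]] [] //= _; rewrite andbT => uc def_b.
by rewrite -def_b uc in nub.
Qed.

Lemma shortest_path_inv u p : shortest_path u p ->
  [\/ p = [::], exists2 a, p = [:: a] & adj u a
    | exists a b, [/\ p = [:: a; b], adj u a, adj a b, u != b & ~~ adj u b]].
Proof.
case/andP=> up /eqP sz_p; have := dist_le2 u (last u p); rewrite -sz_p.
case: p up sz_p => [|a [|b [|//]]] /=; first by constructor 1.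
  by rewrite andbT; constructor 2; exists a.
case/and3P=> ua ab _ d_ub _; constructor 3; exists a, b; split=> //.
  apply: contra_eqN d_ub => /eqP->; rewrite gtn_eqF // ltnS (leq_trans (dist_le (n := 0) _)) //.
  by apply/has_walkP; exists [::].
apply: contra_eqN d_ub => ub; rewrite gtn_eqF // ltnS dist_le //.
by apply/has_walkP; exists [:: b]; rewrite /= ub.
Qed.

Lemma in_line_path x y z u p : shortest_path u p ->
  x \in u :: p -> y \in u :: p -> z \in u :: p -> z \in line x y.
Proof.
move=> up xp yp zp; rewrite inE; apply/existsP; exists u.
have p_lt : size p < #|G|.
  by case/andP: up => _ /eqP->; apply: dist_lt_card.
apply/existsP; exists (Ordinal p_lt); apply/existsP; exists (in_tuple p).
by rewrite up xp yp zp.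
Qed.

Lemma line_mline x y : x != y -> line x y = mline x y.
Proof.
move=> xy; apply/setP => z; rewrite in_mline; apply/idP/idP.
  rewrite inE => /existsP[u /existsP[n /existsP[p /andP[]]]].
  case/shortest_path_inv=> [->|[a -> ua]|[a [b [-> ua ab neq_ub nub]]]].
  - by rewrite !inE => /and3P[/eqP def_x /eqP def_y]; rewrite def_x def_y eqxx in xy.
  - have au : adj a u by rewrite adj_sym.
    rewrite /collinear !inE => /and3P[].
    by do 3!case/orP=> /eqP?; subst; rewrite ?eqxx ?(ua, au, adj_irr) in xy *.
  have au : adj a u by rewrite adj_sym.
  have ba : adj b a by rewrite adj_sym.
  have nbu : adj b u = false by rewrite adj_sym; apply: negbTE.
  rewrite /collinear !inE => /and3P[].
  by do 3!case/or3P=> /eqP?; subst;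
    rewrite ?eqxx ?(ua, ab, au, ba, nbu, negbTE nub, adj_irr, eqxx, orbT) in xy *.
(* The path is [v w] if [z = w], and otherwise [w v z], whose ends are distinct and not adjacent. *)
have z_line v w : adj v w -> adj v z -> ~~ adj w z ->
    exists u p, shortest_path u p /\ {subset [:: v; w; z] <= u :: p}.
  move=> vw vz nwz; have [def_z|neq_zw] := eqVneq z w.
    exists v, [:: w]; split; first exact: shortest_path1.
    by move=> t; rewrite def_z !inE; case/or3P=> ->; rewrite ?orbT.
  exists w, [:: v; z]; split.
    by rewrite shortest_path2 // 1?adj_sym // eq_sym.
  by move=> t; rewrite !inE orbCA.
rewrite /collinear; case: ifPn => [xy_adj|nxy].
  have [xz|nxz] := boolP (adj x z) => [nyz|/= yz].
    have [u [p [up sub_p]]] := z_line x y xy_adj xz nyz.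
    by apply: (in_line_path up); apply: sub_p; rewrite !inE eqxx ?orbT.
  rewrite adj_sym in xy_adj.
  have [u [p [up sub_p]]] := z_line y x xy_adj yz nxz.
  by apply: (in_line_path up); apply: sub_p; rewrite !inE eqxx ?orbT.
(* Distinct non-adjacent vertices are at distance two. The midpoint [w] serves when [z] is [x] or
   [y]; any other [z] is itself a midpoint. *)
have [w xw wy] : exists2 w, adj x w & adj w y.
  have := dist_le2 x y; have := has_walk_dist x y.
  case: (dist x y) => [|[|[|//]]] /has_walkP[].
  - by case=> [|? ?] [] // _ _ /= def_y; rewrite def_y eqxx in xy.
  - case=> [|c [|? ?]] [] //= _; rewrite andbT => xc def_y.
    by rewrite -def_y xc in nxy.
  case=> [|c [|d [|? ?]]] [] //= _ /and3P[xc cd _] def_y _.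
  by exists c; rewrite // -def_y.
have xwy := shortest_path2 xw wy xy nxy.
case/or3P=> [/eqP->|/eqP->|/andP[xz]];
  try by apply: (in_line_path xwy); rewrite !inE eqxx ?orbT.
rewrite adj_sym => zy.
by apply: (in_line_path (shortest_path2 xz zy xy nxy)); rewrite !inE eqxx ?orbT.
Qed.

Lemma lines_mlines : lines G = mlines G.
Proof.
by apply: eq_in_imset => -[x y]; rewrite inE; apply: line_mline.
Qed.

End DiameterTwo.

(** * Lower bounds on the number of lines *)

Section Neighborhoods.
Variable G : graph.
Implicit Types (x y z t : G) (S : {set G}).

Definition nbh x : {set G} := [set z | adj x z].

Lemma mlineC x y : mline x y = mline y x.
Proof. by apply/setP => z; rewrite !inE collinearC //; apply: adj_sym. Qed.

Lemma mline_left x y : x \in mline x y.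
Proof. by rewrite inE /collinear adj_irr adj_sym eqxx; case: adj. Qed.

Lemma mline_right x y : y \in mline x y.
Proof. by rewrite mlineC mline_left. Qed.

Lemma in_mline_adj x y z : adj x y -> (z \in mline x y) = adj x z (+) adj y z.
Proof. by move=> xy; rewrite inE /collinear xy. Qed.

Lemma in_mline_nadj x y z : ~~ adj x y ->
  (z \in mline x y) = [|| z == x, z == y | adj x z && adj y z].
Proof. by move=> nxy; rewrite inE /collinear (negbTE nxy). Qed.

(** Three distinct vertices are collinear exactly when they span two edges, a condition symmetric in
    the three. In particular, triangles are never collinear. *)
Lemma mline_rot x y z : x != y -> y != z -> z != x ->
  (z \in mline x y) = (x \in mline y z).
Proof.
move=> xy yz zx; rewrite !inE /collinear [x == y]eq_sym in xy *.
rewrite eq_sym in yz; rewrite [x == z]eq_sym (negbTE xy) (negbTE yz) (negbTE zx).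
by rewrite [adj z x]adj_sym [adj y x]adj_sym; do 3!case: adj.
Qed.

Lemma mline_adj_inj x y z :
  adj x y -> adj x z -> mline x y = mline x z -> nbh y = nbh z.
Proof.
move=> xy xz /setP eq_l; apply/setP => t; have := eq_l t.
by rewrite !in_mline_adj // !inE => /addbI.
Qed.

Lemma mline_nadj_inj x y z : y != x -> z != x ->
  ~~ adj x y -> ~~ adj x z -> mline x y = mline x z -> y = z.
Proof.
move=> yx zx nxy nxz eq_l; apply/eqP; have := mline_right x y.
by rewrite eq_l in_mline_nadj // (negbTE yx) (negbTE nxy) orbF.
Qed.

Definition avoiding x : {set {set G}} := [set L in mlines G | x \notin L].

Lemma mline_avoiding x y z :
  y != z -> x \notin mline y z -> mline y z \in avoiding x.
Proof. by move=> yz xyz; rewrite inE xyz mline_in. Qed.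

End Neighborhoods.

(** * Graphs without twins *)

Section TwinFree.
Variable G : graph.
Implicit Types (x y z t : G) (S : {set G}).
Hypothesis nbh_inj : injective (@nbh G).

(** Relative to a set [S], taken below as all vertices but [x] and as the complement of a line. *)
Definition pivots x S :=
  [set y in S |
    adj x y && [exists z in S, ~~ adj x z && (mline x y == mline x z)]].

(** [mline x] is injective off the pivots: neighbors with equal lines have equal neighborhoods,
    non-neighbors with equal lines coincide, and the mixed case makes the neighbor a pivot. *)
Lemma card_star x S : x \notin S -> #|S| <= #|pivots x S| + #|mline x @: S|.
Proof.
move=> xS; have neq_x y : y \in S -> y != x by apply: contraTneq => ->.
rewrite -(cardsID (pivots x S) S) leq_add ?subset_leq_card ?subsetIr //.
rewrite -(card_in_imset (f := mline x)) => [|y z].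
  by rewrite subset_leq_card ?imsetS ?subsetDl.
have no_pivot t t' : t \in S :\: pivots x S -> t' \in S -> adj x t ->
    mline x t = mline x t' -> adj x t'.
  rewrite !inE => /andP[nt tS] t'S xt eq_l; apply: contraNT nt => nxt'.
  by rewrite tS xt; apply/existsP; exists t'; rewrite t'S nxt' eq_l eqxx.
move=> yS' zS' eq_l; have [yS zS] : y \in S /\ z \in S.
  by move: yS' zS'; rewrite !inE => /andP[_ ->] /andP[_ ->].
case: (boolP (adj x y)) => xy.
  by have xz := no_pivot _ _ yS' zS xy eq_l; apply/nbh_inj/(mline_adj_inj xy xz).
apply: (mline_nadj_inj _ _ xy _ eq_l); rewrite ?neq_x //.
by apply: contra xy => xz; apply: no_pivot zS' yS xz (esym eq_l).
Qed.

(** Adding [nbh x] (symmetric difference) to both sides of [mline x y = mline x z] recovers the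
    neighborhood of [y]. *)
Lemma pivotP x S y : x \notin S -> y \in pivots x S ->
  exists z, [/\ z \in S, ~~ adj x z, adj x y, mline x y = mline x z &
    forall t, adj y t = [|| t == x, t == z | adj x t && ~~ adj z t]].
Proof.
move=> xS; rewrite inE => /and3P[yS xy /existsP[z /and3P[zS nxz /eqP eq_l]]].
exists z; split=> // t; have /setP/(_ t) := eq_l.
rewrite in_mline_adj // in_mline_nadj // => eq_t.
have -> : adj y t = adj x t (+) (adj x t (+) adj y t) by rewrite addbA addbb.
rewrite eq_t; have [->|_] := eqVneq t x; first by rewrite adj_irr.
by have [->|_] := eqVneq t z; [rewrite (negbTE nxz)|do 2!case: adj].
Qed.

(** Apart from [x], the only non-neighbor of [x] adjacent to a pivot is its own partner [z], and
    partners differ by twin-freeness. Hence [y'] is in N(x) but not in N(z), so it is adjacent to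
    [y]. *)
Lemma pivots_clique x S y y' : x \notin S ->
  y \in pivots x S -> y' \in pivots x S -> y != y' -> adj y y'.
Proof.
move=> xS yP y'P neq_yy'; have neq_x z : z \in S -> z != x by apply: contraTneq => ->.
have [z [zS nxz xy _ yE]] := pivotP xS yP.
have [z' [z'S nxz' xy' _ y'E]] := pivotP xS y'P.
have neq_zz' : z != z'.
  apply: contraNneq neq_yy' => eq_z; apply/eqP/nbh_inj/setP => t.
  by rewrite !inE yE y'E eq_z.
rewrite yE xy' [adj z y']adj_sym y'E (negbTE neq_zz') (negbTE (neq_x z zS)).
by rewrite (negbTE nxz) !orbT.
Qed.

Lemma card_clique_star (P : {set G}) y :
    y \in P -> {in P &, forall t t', t != t' -> adj t t'} ->
  #|P|.-1 = #|mline y @: (P :\ y)|.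
Proof.
move=> yP cliqueP; rewrite (cardsD1 y) yP /= card_in_imset // => t t'.
rewrite !inE => /andP[ty tP] /andP[t'y t'P] eq_l; apply: nbh_inj.
by apply: mline_adj_inj eq_l; apply: cliqueP; rewrite // eq_sym.
Qed.

Notation pivots1 x := (pivots x [set~ x]).

Lemma card_avoiding x :
  #|G| + #|avoiding x| <= #|pivots1 x| + #|mlines G| + 1.
Proof.
have := @card_star x [set~ x]; rewrite !inE eqxx => /(_ isT).
rewrite cardsC1 => star.
have dis : [disjoint mline x @: [set~ x] & avoiding x].
  rewrite disjoint_subset; apply/subsetP => L /imsetP[y _ ->].
  by rewrite !inE -in_mline mline_left andbF.
have sub : (mline x @: [set~ x]) :|: avoiding x \subset mlines G.
  rewrite subUset; apply/andP; split; apply/subsetP => L.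
    by case/imsetP=> y; rewrite !inE => yx ->; rewrite mline_in // eq_sym.
  by rewrite inE => /andP[].
have := subset_leq_card sub; rewrite cardsU (disjoint_setI0 dis) cards0 subn0.
move=> le_lines.
have G0 : 0 < #|G| by apply/card_gt0P; exists x.
have arith (n p t a l : nat) :
  n.-1 <= p + t -> t + a <= l -> 0 < n -> n + a <= p + l + 1 by clear; lia.
exact: arith star le_lines G0.
Qed.

(** For a common neighbor [z], the triangle on [x], [y], [z] keeps [x] off the line of [y] and
    [z]. *)
Lemma card_common_nbh x y : adj x y -> #|nbh x :&: nbh y| <= #|avoiding x|.
Proof.
move=> xy; rewrite -(card_in_imset (f := mline y)) => [|z t]; last first.
  rewrite !inE => /andP[_ yz] /andP[_ yt] eq_l.
  by apply/nbh_inj/(mline_adj_inj yz yt).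
apply/subset_leq_card/subsetP => L /imsetP[z /setIP[xz yz] ->].
rewrite !inE in xz yz.
apply: mline_avoiding; first by apply: contraTneq yz => ->; rewrite adj_irr.
by rewrite in_mline_adj // ![adj _ x]adj_sym xy xz.
Qed.

(** By [mline_rot], the lines from [y] to the complement [D] avoid [x]. The pivots of [y] in [D]
    form a clique; the lines from one of them to the others avoid [x] and also [y], hence are new,
    and make up for all pivots but one. *)
Lemma card_compl_mline x y :
  y \in pivots1 x -> #|~: mline x y| <= #|avoiding x| + 1.
Proof.
have xS : x \notin [set~ x] by rewrite !inE eqxx.
case/(pivotP xS) => z [_ _ xy _ _].
set D := ~: _; have yD : y \notin D by rewrite inE mline_right.
have neq_xy : x != y by apply: contraTneq xy => ->; rewrite adj_irr.
have sub1 : mline y @: D \subset avoiding x.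
  apply/subsetP => L /imsetP[w /setCP/negP xyw ->].
  have neq_wx : w != x by apply: contraNneq xyw => ->; apply: mline_left.
  have neq_yw : y != w by apply: contraNneq xyw => <-; apply: mline_right.
  by rewrite mline_avoiding // -mline_rot.
apply: leq_trans (card_star yD) _.
have [->|[p pP]] := set_0Vmem (pivots y D).
  by rewrite cards0 (leq_trans (subset_leq_card sub1)) ?leq_addr.
have [_ [_ _ yp _ _]] := pivotP yD pP.
(* A neighbor of [y] off the line of [x] and [y] is also a neighbor of [x]. *)
have pD w : w \in pivots y D -> adj x w && adj y w.
  rewrite inE => /and3P[]; rewrite inE in_mline_adj // => nxyw yw _.
  by move: nxyw; rewrite yw; case: adj.
have P0 : 0 < #|pivots y D| by apply/card_gt0P; exists p.
rewrite -(prednK P0) addSn -addn1 leq_add2r.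
have cliqueP : {in pivots y D &, forall t t', t != t' -> adj t t'}.
  by move=> t t'; apply: pivots_clique.
rewrite (card_clique_star pP cliqueP).
set M := mline p @: _; have sub2 : M \subset avoiding x :&: avoiding y.
  apply/subsetP => L /imsetP[w]; rewrite !in_setD1 => /andP[wp wP] ->.
  have pw : adj p w by apply: (pivots_clique yD); rewrite // eq_sym.
  have [/andP[xp _] /andP[xw yw]] := (pD p pP, pD w wP).
  have avoids v : adj v p -> adj v w -> mline p w \in avoiding v.
    move=> vp vw; rewrite mline_avoiding 1?eq_sym // in_mline_adj //.
    by rewrite ![adj _ v]adj_sym vp vw.
  by rewrite inE !avoids.
have dis : [disjoint M & mline y @: D].
  rewrite disjoint_subset; apply/subsetP => L /(subsetP sub2).
  rewrite !inE => /andP[_ /andP[_ yL]]; apply: contra yL => /imsetP[w _ ->].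
  exact: mline_left.
have := subset_leq_card (_ : M :|: mline y @: D \subset avoiding x).
rewrite cardsU (disjoint_setI0 dis) cards0 subn0; apply.
by rewrite subUset sub1 (subset_trans sub2) ?subsetIl.
Qed.

(** If every line contains [x], each edge has exactly one end in N(x), all neighbors of [x] have the
    same neighborhood, and [x] has at most one non-neighbor besides itself. Without twins this
    leaves at most three vertices. *)
Lemma avoiding_gt0 x : 3 < #|G| -> 0 < #|avoiding x|.
Proof.
move=> G_gt3; rewrite lt0n; apply/negP => /eqP/cards0_eq av0.
have all_x y z : y != z -> x \in mline y z.
  move=> yz; apply/negPn/negP => xyz.
  by have := mline_avoiding yz xyz; rewrite av0 inE.
have adj_x y z : adj y z -> adj x y = ~~ adj x z.
  move=> yz; have := all_x y z; rewrite in_mline_adj // ![adj _ x]adj_sym.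
  rewrite (contraTneq _ yz) => [/(_ isT)|->]; last by rewrite adj_irr.
  by case: adj; case: adj.
have sub_nbh y y' t : adj x y -> adj x y' -> adj y t -> adj y' t.
  move=> xy xy' yt; apply/negPn/negP => ny't.
  have neq_xt : x != t by apply: contraNneq ny't => <-; rewrite adj_sym.
  have nxt : ~~ adj x t by rewrite -(adj_x _ _ yt).
  have neq_y't : y' != t by apply: contraTneq xy' => ->.
  have := all_x _ _ neq_y't; rewrite in_mline_nadj // (negbTE neq_xt).
  rewrite ![adj _ x]adj_sym (negbTE nxt) andbF !orbF => /eqP def_x.
  by rewrite def_x adj_irr in xy'.
have nbh_gt1 : 1 < #|nbh x|.
  have := cardsC (nbh x); rewrite (cardsD1 x (~: _)) !inE adj_irr.
  have: #|~: nbh x :\ x| <= 1.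
    apply/card_le1_eqP => z t; rewrite !inE => /andP[zx nxz] /andP[tx nxt].
    apply/eqP/negPn/negP => neq_zt; have := all_x t z neq_zt; rewrite inE /collinear.
    by rewrite ![adj _ x]adj_sym (negbTE nxz) (negbTE nxt) ![x == _]eq_sym
      (negbTE zx) (negbTE tx) if_same.
  case: #|_ :\ _| => [|[|//]] _ /eqP; rewrite ?addn0 ?addn1 ?addn2.
    by move/eqP=> eq_n; rewrite -ltnS ltnW // -addn1 eq_n.
  by move/eqP=> eq_n; rewrite -ltnS -ltnS -addn2 eq_n.
case/card_gt1P: nbh_gt1 => y [y' [xy xy']]; rewrite !inE in xy xy'.
case/eqP; apply: nbh_inj; apply/setP => t; rewrite !inE.
by apply/idP/idP; apply: sub_nbh.
Qed.

(** For pivots [y] and [y'] among c, the c - 1 lines from [y] within the clique contain [y], the c -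
    2 lines from [y'] to the rest miss it, and all avoid [x]. So 2c - 3 <= c. *)
Lemma card_pivots_le3 x : #|mlines G| < #|G| -> #|pivots1 x| <= 3.
Proof.
move=> G_few; have xS : x \notin [set~ x] by rewrite !inE eqxx.
set P := pivots1 x; rewrite leqNgt; apply/negP => P_gt3.
have cliqueP : {in P &, forall t t', t != t' -> adj t t'}.
  by move=> t t'; apply: pivots_clique.
have adj_P t : t \in P -> adj x t by case/(pivotP xS) => z [].
have /card_gt0P[y yP] : 0 < #|P| by apply: ltn_trans P_gt3.
have card_P := cardsD1 y P; rewrite yP in card_P.
have /card_gt0P[y' y'Q] : 0 < #|P :\ y| by lia.
have [y'y y'P] : y' != y /\ y' \in P by move: y'Q; rewrite !inE => /andP[-> ->].
have cliqueQ : {in P :\ y &, forall t t', t != t' -> adj t t'}.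
  by move=> t t'; rewrite !in_setD1 => /andP[_ tP] /andP[_ t'P]; apply: cliqueP.
have star := card_clique_star yP cliqueP; have star' := card_clique_star y'Q cliqueQ.
set M := mline y @: _ in star; set M' := mline y' @: _ in star'.
have dis : [disjoint M' & M].
  rewrite disjoint_subset; apply/subsetP => L /imsetP[w].
  rewrite !in_setD1 => /and3P[wy' wy wP] ->; rewrite inE; apply/imsetP=> -[w' _ eq_l].
  have := mline_left y w'; rewrite -eq_l in_mline_adj; last by rewrite cliqueP // eq_sym.
  by rewrite !cliqueP.
have sub : M' :|: M \subset avoiding x.
  rewrite subUset; apply/andP; split; apply/subsetP => L /imsetP[w].
    rewrite !in_setD1 => /and3P[wy' wy wP] ->; have y'w : adj y' w by rewrite cliqueP // eq_sym.
    by rewrite mline_avoiding 1?eq_sym // in_mline_adj // ![adj _ x]adj_sym !adj_P.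
  rewrite !in_setD1 => /andP[wy wP] ->; have yw : adj y w by rewrite cliqueP // eq_sym.
  by rewrite mline_avoiding 1?eq_sym // in_mline_adj // ![adj _ x]adj_sym !adj_P.
have := subset_leq_card sub; rewrite cardsU (disjoint_setI0 dis) cards0 subn0.
rewrite -star -star' => le_av.
have arith (n a p q l : nat) : n + a <= p + l + 1 -> l < n -> p = 1 + q ->
  3 < p -> q.-1 + p.-1 <= a -> False by clear; lia.
exact: arith (card_avoiding x) G_few card_P P_gt3 le_av.
Qed.

Lemma card_mlines_twin_free : 9 < #|G| -> #|G| <= #|mlines G|.
Proof.
move=> G_gt9; rewrite leqNgt; apply/negP => G_few.
have pivot_ex x : exists y, y \in pivots1 x.
  have G_gt3 : 3 < #|G| by apply: leq_trans G_gt9.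
  apply/card_gt0P; have arith (n a p l : nat) :
    n + a <= p + l + 1 -> l < n -> 0 < a -> 0 < p by clear; lia.
  exact: arith (card_avoiding x) G_few (avoiding_gt0 x G_gt3).
have avoiding_le x : #|avoiding x| <= #|pivots1 x|.
  have arith (n a p l : nat) : n + a <= p + l + 1 -> l < n -> a <= p by clear; lia.
  exact: arith (card_avoiding x) G_few.
have out x : x \notin [set~ x] by rewrite !inE eqxx.
have /card_gt0P[x _] : 0 < #|G| by apply: leq_trans G_gt9.
have [y yP] := pivot_ex x; have [z [_ nxz xy _ yE]] := pivotP (out x) yP.
have [p pP] := pivot_ex y; have [q [qy nyq yp def_l pE]] := pivotP (out y) pP.
have nbh_y_le : #|nbh y| <= 2 + #|nbh x :&: nbh y|.
  have sub : nbh y \subset [set x; z] :|: (nbh x :&: nbh y).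
    apply/subsetP => t; rewrite !inE => yt; have := yE t.
    by rewrite yt => /esym/or3P[->|->|/andP[->]]; rewrite ?orbT.
  apply: leq_trans (subset_leq_card sub) (leq_trans (leq_card_setU _ _) _).
  by rewrite leq_add2r cards2; case: (x != z).
(* A pivot [t] of [y] other than [p] is adjacent to [p]; the neighborhood of [p] given by [pE] then
   excludes [t] from N(q). *)
have nbh_y_ge : #|nbh y :&: nbh q| + #|pivots1 y :\ p| <= #|nbh y|.
  have dis : [disjoint nbh y :&: nbh q & pivots1 y :\ p].
    rewrite disjoint_subset; apply/subsetP => t /setIP[yt qt].
    rewrite !inE in yt qt; rewrite inE in_setD1; apply/negP => /andP[tp tP].
    have := pivots_clique (out y) pP tP; rewrite eq_sym => /(_ tp).
    rewrite pE qt andbF orbF => /orP[] /eqP def_t.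
      by rewrite def_t adj_irr in yt.
    by rewrite def_t adj_irr in qt.
  have := subset_leq_card (_ : nbh y :&: nbh q :|: pivots1 y :\ p \subset nbh y).
  rewrite cardsU (disjoint_setI0 dis) cards0 subn0; apply.
  rewrite subUset subsetIl; apply/subsetP => t; rewrite in_setD1 => /andP[_].
  by case/(pivotP (out y)) => q' [_ _ yt _ _]; rewrite inE.
have card_l : #|mline y p| <= 2 + #|nbh y :&: nbh q|.
  have sub : mline y p \subset [set y; q] :|: (nbh y :&: nbh q).
    by apply/subsetP => t; rewrite def_l in_mline_nadj // !inE orbA.
  apply: leq_trans (subset_leq_card sub) (leq_trans (leq_card_setU _ _) _).
  by rewrite leq_add2r cards2; case: (y != q).
(* Counting the line of [y] and [p] and its complement gives n <= deg(y) + 4, while deg(y) <= 5. *)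
have arith (n l l' a b c c' d e f : nat) :
    9 < n -> l + l' = n -> l' <= b + 1 -> b <= c + 1 -> l <= 2 + d ->
    d + c <= e -> e <= 2 + f -> f <= a -> a <= c' -> c' <= 3 -> False by clear; lia.
have card_p := cardsD1 p (pivots1 y); rewrite pP in card_p.
apply: (arith _ _ _ _ _ _ _ _ _ _ G_gt9 (cardsC (mline y p)) (card_compl_mline pP)
  _ card_l nbh_y_ge nbh_y_le (card_common_nbh xy) (avoiding_le x) (card_pivots_le3 x G_few)).
by have := avoiding_le y; rewrite card_p addnC.
Qed.

End TwinFree.

(** * Lines generated inside a vertex subset *)

Section Induced.
Variables (G : graph) (A : {set G}).

Definition induced_adj : rel {x : G | x \in A} := relpre val adj.

Lemma induced_sym : symmetric induced_adj.
Proof. by move=> x y; apply: adj_sym. Qed.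

Lemma induced_irr : irreflexive induced_adj.
Proof. by move=> x; apply: adj_irr. Qed.

Definition induced : graph := Graph induced_sym induced_irr.

(** These are full lines of [G]; intersecting them with [A] gives all lines of the induced
    subgraph. *)
Definition lines_in : {set {set G}} :=
  [set mline xy.1 xy.2
     | xy : G * G & [&& xy.1 \in A, xy.2 \in A & xy.1 != xy.2]].

Lemma lines_inP L : L \in lines_in ->
  exists x y, [/\ x \in A, y \in A, x != y & L = mline x y].
Proof.
by case/imsetP=> -[x y]; rewrite inE /= => /and3P[xA yA xy] ->; exists x, y.
Qed.

Lemma lines_in_sub : lines_in \subset mlines G.
Proof. by apply/subsetP => L /lines_inP[x [y [_ _ xy ->]]]; apply: mline_in. Qed.

Lemma card_induced : #|induced| = #|A|.
Proof. exact: card_sig. Qed.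

Lemma card_mlines_induced : #|mlines induced| <= #|lines_in|.
Proof.
pose trace (L : {set G}) : {set induced} := [set x | val x \in L].
apply: leq_trans (leq_imset_card trace (mem lines_in)).
apply/subset_leq_card/subsetP => L /mlinesP[x [y [xy ->]]].
apply/imsetP; exists (mline (val x) (val y)).
  by apply/imsetP; exists (val x, val y); rewrite ?inE ?(valP x) ?(valP y).
by apply/setP => z; rewrite !inE.
Qed.

End Induced.

(** * Graphs with twins *)

Section Twins.
Variable G : graph.
Implicit Types (x y z : G).

Definition twins x y := (x != y) && (nbh x == nbh y).

Lemma twins_adj x y z : twins x y -> adj x z = adj y z.
Proof. by case/andP=> _ /eqP/setP/(_ z); rewrite !inE. Qed.

Lemma twins_nadj x y : twins x y -> ~~ adj x y.
Proof. by move=> xy; rewrite (twins_adj _ xy) adj_irr. Qed.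

Hypothesis few_lines : #|mlines G| < #|G|.
Hypothesis lines_ge : forall H : graph, #|H| = #|G| - 2 -> #|H| <= #|mlines H|.

(** [lines_ge] is the induction hypothesis: the pairs off the twins generate at least n - 2 lines,
    which leaves room for at most one more. *)
Lemma twins_new_lines u u' L L' : twins u u' ->
  L \in mlines G -> L' \in mlines G -> L != L' ->
  (L \in lines_in (~: [set u; u'])) || (L' \in lines_in (~: [set u; u'])).
Proof.
case/andP=> neq_u _ L_line L'_line neq_L; set A := ~: _; apply/negPn/negP.
rewrite negb_or => /andP[LA L'A].
have card_A : #|A| = #|G| - 2 by rewrite cardsCs setCK cards2 neq_u.
have := lines_ge (etrans (card_induced A) card_A).
rewrite card_induced card_A => /leq_trans/(_ (card_mlines_induced A)).
have sub : [set L; L'] :|: lines_in A \subset mlines G.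
  rewrite subUset lines_in_sub andbT; apply/subsetP => M.
  by rewrite !inE => /orP[]/eqP->.
have dis : [disjoint [set L; L'] & lines_in A].
  rewrite disjoint_subset; apply/subsetP => M.
  by rewrite !inE => /orP[]/eqP->.
have := subset_leq_card sub; rewrite cardsU (disjoint_setI0 dis) cards0 subn0.
rewrite cards2 neq_L => le1 le2.
have arith (n e l : nat) : 2 + e <= l -> n - 2 <= e -> l < n -> False by clear; lia.
exact: arith le1 le2 few_lines.
Qed.

Lemma twins_adj_all u u' z : twins u u' -> z != u -> z != u' -> adj u z.
Proof.
move=> uu' zu zu'; apply/negPn/negP => nuz.
have nu'z : ~~ adj u' z by rewrite -(twins_adj z uu').
have neq_u : u != u' by case/andP: uu'.
have split_u (v v' w : G) : v != v' -> w != v' -> ~~ adj v w -> ~~ adj v v' ->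
    v' \notin mline v w.
  move=> vv' wv' nvw nvv'; rewrite in_mline_nadj // ![v' == _]eq_sym.
  by rewrite (negbTE vv') (negbTE wv') (negbTE nvv').
have nuu' := twins_nadj uu'.
have u'L := split_u _ _ _ neq_u zu' nuz nuu'.
have uL' : u \notin mline u' z.
  by apply: split_u; rewrite // 1?eq_sym // adj_sym.
(* A line generated off the twins cannot separate them. *)
have no_split L : L \in lines_in (~: [set u; u']) -> (u \in L) = (u' \in L).
  case/lines_inP=> a [b []]; rewrite !inE !negb_or => /andP[au au'] /andP[bu bu'] _ ->.
  rewrite !in_mline /collinear ![_ == a]eq_sym ![_ == b]eq_sym.
  by rewrite (negbTE au) (negbTE au') (negbTE bu) (negbTE bu') ![adj _ u]adj_sym
    ![adj _ u']adj_sym !(twins_adj _ uu').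
have uz : mline u z \in mlines G by rewrite mline_in // eq_sym.
have u'z : mline u' z \in mlines G by rewrite mline_in // eq_sym.
have neq_L : mline u z != mline u' z.
  by apply: contraNneq u'L => ->; apply: mline_left.
case/orP: (twins_new_lines uu' uz u'z neq_L) => /no_split.
  by rewrite mline_left (negbTE u'L).
by rewrite mline_left (negbTE uL').
Qed.

Lemma twins_adjE u u' z : twins u u' -> adj u z = (z != u) && (z != u').
Proof.
move=> uu'; apply/idP/andP => [uz|[zu zu']]; last exact: twins_adj_all uu' zu zu'.
split; first by apply: contraTneq uz => ->; rewrite adj_irr.
by apply: contraTneq uz => ->; apply: twins_nadj.
Qed.

Lemma unique_twins u u' v v' : 4 < #|G| ->
  twins u u' -> twins v v' -> v \in [set u; u'].
Proof.
move=> G_gt4 uu' vv'; apply/negPn/negP; rewrite !inE negb_or => /andP[vu vu'].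
have uE z := twins_adjE z uu'; have vE z := twins_adjE z vv'.
have u'E z : adj u' z = adj u z by rewrite (twins_adj z uu').
have v'E z : adj v' z = adj v z by rewrite (twins_adj z vv').
have uv : adj u v by rewrite uE vu vu'.
have [r] : exists r, r \notin [set u; u'] :|: [set v; v'].
  apply/existsP; rewrite -negb_forall; apply/negP => /forallP all_r.
  have: #|[set: G]| <= #|[set u; u'] :|: [set v; v']|.
    by apply/subset_leq_card/subsetP => r _; apply: all_r.
  rewrite cardsT => /leq_trans/(_ (leq_card_setU _ _)).
  by rewrite !cards2; lia.
rewrite !inE !negb_or => /andP[/andP[ru ru'] /andP[rv rv']].
have ur : adj u r by rewrite uE ru ru'.
have vr : adj v r by rewrite vE rv rv'.
have vL : v \notin mline u r by rewrite in_mline_adj // uv [adj r v]adj_sym vr.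
have rL : r \notin mline u v by rewrite in_mline_adj // ur vr.
have neq_L : mline u v != mline u r.
  by apply: contraNneq vL => <-; apply: mline_right.
have neq_uv : u != v by rewrite eq_sym.
have neq_ur : u != r by rewrite eq_sym.
have uA c : c \in ~: [set u; u'] -> adj u c by rewrite !inE negb_or -uE.
have nadj a b : a \in ~: [set u; u'] -> b \in ~: [set u; u'] -> u \in mline a b -> ~~ adj a b.
  move=> /uA ua /uA ub; apply: contraL => ab.
  by rewrite in_mline_adj // ![adj _ u]adj_sym ua ub.
case/orP: (twins_new_lines uu' (mline_in neq_uv) (mline_in neq_ur) neq_L).
  (* [a] and [b] are adjacent to [u] and on its line with [v], so not adjacent to [v]: both lie in
     [{v, v'}]. Being adjacent to [r], they put [r] on the line. *)
  case/lines_inP=> a [b [aA bA ab def_L]].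
  have nab := nadj a b aA bA; rewrite -def_L mline_left in nab.
  have inv c : c \in ~: [set u; u'] -> c \in mline u v -> ~~ adj v c.
    by move=> /uA uc; rewrite in_mline_adj // uc; case: adj.
  have va : ~~ adj v a by rewrite inv // def_L mline_left.
  have vb : ~~ adj v b by rewrite inv // def_L mline_right.
  have twin_r c : ~~ adj v c -> adj c r.
    by rewrite vE negb_and !negbK => /orP[]/eqP->; rewrite ?v'E.
  by move: rL; rewrite def_L in_mline_nadj ?nab // !twin_r ?orbT.
case/lines_inP=> a [b [aA bA ab def_L]].
have nab := nadj a b aA bA; rewrite -def_L mline_left in nab.
move: vL; rewrite def_L in_mline_nadj ?nab // !negb_or => /and3P[va vb].
(* Only [v'] could be missed by [v], but [v'] is adjacent to every [d] outside [{v, v'}]. So [v] is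
   a common neighbor of [a] and [b], hence on their line. *)
have near c d : v != c -> ~~ adj c d -> v != d -> c != d -> adj v c.
  move=> vc ncd vd cd; rewrite vE [c == v]eq_sym vc; apply: contraNneq ncd => def_c.
  by rewrite def_c v'E vE [d == v]eq_sym vd eq_sym -def_c.
rewrite ![adj _ v]adj_sym (near a b) ?nab //= (near b a) // 1?eq_sym //.
by rewrite adj_sym nab.
Qed.

Lemma no_twins u u' : 5 < #|G| -> ~~ twins u u'.
Proof.
move=> G_gt5; apply/negP => uu'; set A := ~: [set u; u'].
have neq_uu' : u != u' by case/andP: uu'.
have u'E z : adj u' z = adj u z by rewrite (twins_adj z uu').
have uA r : (r \in A) = adj u r by rewrite (twins_adjE r uu') !inE negb_or.
have nbh_inj : {in A &, injective (@nbh G)}.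
  move=> r r' rA _ eq_r; apply/eqP/negPn/negP => neq_r.
  have rr' : twins r r' by rewrite /twins neq_r eq_r eqxx.
  by have := unique_twins (ltnW G_gt5) uu' rr'; apply/negP; rewrite inE in rA.
have card_A : #|A| = #|G| - 2 by rewrite cardsCs setCK cards2 neq_uu'.
have card_star : #|mline u @: A| = #|G| - 2.
  rewrite card_in_imset // => r r' rA r'A eq_l; apply: nbh_inj => //.
  by apply: mline_adj_inj eq_l; rewrite -uA.
(* Two different lines from edges inside [A] avoid [u], so together with the n - 2 lines through [u]
   they would be too many. *)
have one_line r a r' a' : r \in A -> a \in A -> r' \in A -> a' \in A ->
    adj r a -> adj r' a' -> mline r a = mline r' a'.
  rewrite !uA => ur ua ur' ua' ra ra'; apply/eqP/negPn/negP => neq_l.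
  have avoid v w : adj u v -> adj u w -> adj v w -> mline v w \in avoiding u.
    move=> uv uw vw; rewrite mline_avoiding //.
      by apply: contraTneq vw => ->; rewrite adj_irr.
    by rewrite in_mline_adj // ![adj _ u]adj_sym uv uw.
  have sub : [set mline r a; mline r' a'] \subset avoiding u.
    by rewrite subUset !sub1set !avoid.
  have dis : [disjoint mline u @: A & [set mline r a; mline r' a']].
    rewrite disjoint_subset; apply/subsetP => L /imsetP[w _ ->].
    rewrite inE; apply/negP => /(subsetP sub).
    by rewrite inE mline_left andbF.
  have sub' : mline u @: A :|: [set mline r a; mline r' a'] \subset mlines G.
    rewrite subUset (subset_trans sub) ?andbT; last first.
      by apply/subsetP => L; rewrite inE => /andP[].
    apply/subsetP => L /imsetP[w]; rewrite uA => uw ->; apply: mline_in.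
    by apply: contraTneq uw => ->; rewrite adj_irr.
  have := subset_leq_card sub'; rewrite cardsU (disjoint_setI0 dis) cards0 subn0.
  rewrite cards2 neq_l card_star => le_l.
  have arith (n l : nat) : n - 2 + 2 <= l -> l < n -> 5 < n -> False by clear; lia.
  exact: arith le_l few_lines G_gt5.
have one_nbr r a b : r \in A -> a \in A -> b \in A -> adj r a -> adj r b -> a = b.
  move=> rA aA bA ra rb; apply: nbh_inj => //.
  by apply: (mline_adj_inj ra rb); apply: one_line.
(* Two vertices of [A] with no neighbor in [A] would both have neighborhood [{u, u'}]. *)
have edge x y : exists r a, [/\ r \in A, a \in A, adj r a & r \notin [:: x; y]].
  have /card_gt1P[r [r' [rA r'A neq_r]]] : 1 < #|A :\ x :\ y|.
    have := cardsD1 x A; have := cardsD1 y (A :\ x); rewrite card_A.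
    have arith (n a b c d : nat) :
      a <= 1 -> c <= 1 -> 5 < n -> b = a + d -> n - 2 = c + b -> 1 < d by clear; lia.
    exact: arith (leq_b1 _) (leq_b1 _) G_gt5.
  move: rA r'A; rewrite !in_setD1 => /and3P[ry rx rA] /and3P[r'y r'x r'A].
  have [/existsP[a /andP[aA ra]]|iso_r] := boolP [exists a in A, adj r a].
    by exists r, a; split; rewrite // !inE negb_or rx ry.
  have [/existsP[a /andP[aA ra]]|iso_r'] := boolP [exists a in A, adj r' a].
    by exists r', a; split; rewrite // !inE negb_or r'x r'y.
  have adjE s t : s \in A -> ~~ [exists a in A, adj s a] -> adj s t = (t \in [set u; u']).
    rewrite uA adj_sym => su iso_s; have [tA|] := boolP (t \in A).
      have := tA; rewrite inE => /negbTE->; apply/negbTE.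
      by apply: contra iso_s => st; apply/existsP; exists t; rewrite tA.
    rewrite inE negbK => tu; rewrite tu.
    by case/set2P: tu => ->; rewrite // adj_sym u'E adj_sym.
  case/eqP: neq_r; apply: nbh_inj => //.
  by apply/setP => t; rewrite [LHS]inE [RHS]inE !adjE.
have [r [a [rA aA ra _]]] := edge u u.
have [r' [a' [r'A a'A ra' ]]] := edge r a; rewrite !inE negb_or => /andP[r'r r'a].
(* As [r] is on the line of [r'] and [a'], it is adjacent to one of them; uniqueness of neighbors
   inside [A] then forces [r'] to be [a] or [r]. *)
have := mline_left r a; rewrite (one_line r a r' a') // in_mline_adj //.
have [r'r_adj _|_ /= a'r] := boolP (adj r' r).
  by case/eqP: r'a; apply: (one_nbr r) => //; rewrite adj_sym.
have def_a : a = a' by apply: (one_nbr r); rewrite // adj_sym.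
by case/eqP: r'r; apply: (one_nbr a) => //; rewrite adj_sym // def_a.
Qed.

End Twins.

(** For 9 or 10 vertices the enumeration already gives ten lines. Above ten, removing two twins
    leaves at least nine vertices, so the induction applies. *)
Lemma card_mlines_ge (G : graph) : 8 < #|G| -> #|G| <= #|mlines G|.
Proof.
have [n le_n] := ubnP #|G|; elim: n => // n IHn in G le_n *.
move=> G_gt8; have lines_gt9 := card_mlines9 G_gt8.
have [le_G10|G_gt10] := leqP #|G| 10; first exact: leq_trans lines_gt9.
rewrite leqNgt; apply/negP => G_few.
have lines_ge (H : graph) : #|H| = #|G| - 2 -> #|H| <= #|mlines H|.
  by move=> card_H; apply: IHn; rewrite card_H; lia.
have nbh_inj : injective (@nbh G).
  move=> x y eq_xy; apply/eqP/negPn/negP => neq_xy.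
  have G_gt5 : 5 < #|G| by lia.
  by have /negP[] := no_twins G_few lines_ge x y G_gt5; rewrite /twins neq_xy eq_xy eqxx.
by have := card_mlines_twin_free nbh_inj (ltnW G_gt10); rewrite leqNgt G_few.
Qed.

Theorem theorem1 (G : graph) (diamG : diameter_two G) :
  #|lines G| < #|G| <-> exists H : graph, List.In H familyF /\ iso G H.
Proof.
rewrite lines_mlines //; split; last exact: card_mlines_family.
move=> G_few; apply: family_card_mlines (G_few); rewrite card_gt2 //=.
by rewrite ltnNge; apply: contraL G_few => /card_mlines_ge; rewrite -leqNgt.
Qed.
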